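(* Let $n\ge 2$, $N\ge 1$, let $\Omega\subset\mathbb{R}^n$ be a bounded open set, and let $f:\Omega\times\mathbb{R}^{N\times n}\to\mathbb{R}$ be such that $x\mapsto f(x,z)$ is measurable for every $z$. Assume that there exist constants $K_1\ge 1$, $K_2,K_3\ge 0$, $\sigma>0$, $1<p<q$ such that: (F1) $q\le p\left(1+\frac{\sigma}{n}\right)$; (F2) $|z|^p\le f(x,z)\le K_1 f(\tilde x,z)+K_2|x-\tilde x|^{\sigma}|z|^q+K_3$ for every $x,\tilde x\in\Omega$ and every $z\in\mathbb{R}^{N\times n}$; (F3) for every $x\in\Omega$, the function $z\mapsto f(x,z)$ is convex; (F4) for every $x\in\Omega$ and every $\varepsilon>0$ with $\overline{B(x,\varepsilon)}\subset\Omega$, there exists $y^*\in\overline{B(x,\varepsilon)}$ such that $f(y^*,z)\le f(y,z)$ for all $y\in\overline{B(x,\varepsilon)}$ and all $z\in\mathbb{R}^{N\times n}$. Then for every $L>0$ and every $\epsilon^*\in(0,1)$ the following holds: for every $\epsilon\in(0,\epsilon^* )$, every $x\in\Omega$ with $\overline{B(x,\epsilon)}\subset\Omega$, and every $z\in\mathbb{R}^{N\times n}$, $$|z|^p+(f^-_{x,\epsilon})^{**}(z)\le L\epsilon^{-n}\quad\Longrightarrow\quad f(x,z)\le A\left[(f^-_{x,\epsilon})^{**}(z)+K_3+|z|^p\right],\qquad\text{where } A=K_1+K_2L^{\frac{q-p}{p}}.$$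
   Context: $B(x,\epsilon)$ is the open ball in $\mathbb{R}^n$ with center $x$ and radius $\epsilon$, and $\overline{B(x,\epsilon)}$ is its closure. For $x\in\Omega$ and $\epsilon>0$ with $\overline{B(x,\epsilon)}\subset\Omega$, and $z\in\mathbb{R}^{N\times n}$, $f^-_{x,\epsilon}(z)$ denotes the essential infimum (with respect to Lebesgue measure) of $y\mapsto f(y,z)$ over $y\in B(x,\epsilon)$. For a function $h$ on $\mathbb{R}^{N\times n}$, $h^{**}$ denotes the highest (largest) convex function that does not exceed $h$. $|z|$ is the Euclidean norm on $\mathbb{R}^{N\times n}$. *)

(* Defs.v *)
From HB Require Import structures.
From mathcomp Require Import all_boot all_order all_algebra.
From mathcomp Require Import all_classical all_reals all_analysis ess_sup_inf.

Set Implicit Arguments.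
Unset Strict Implicit.
Unset Printing Implicit Defensive.

Import Order.TTheory GRing.Theory Num.Theory.
Import numFieldNormedType.Exports.

Local Open Scope classical_set_scope.
Local Open Scope ring_scope.

(* The library norm on matrices is the sup norm, hence the Euclidean
   (Frobenius) norm and the Euclidean open ball below. *)
Definition enorm (R : realType) (m n : nat) (A : 'M[R]_(m, n)) : R :=
  Num.sqrt (\sum_(i < m) \sum_(j < n) A i j ^+ 2).

Definition eball (R : realType) (n : nat) (x : 'rV[R]_n) (e : R) :
    set 'rV[R]_n :=
  [set y | enorm (y - x) < e].

Section lebesgue_measure_rV.
Variables (R : realType) (n : nat).
Implicit Types (A : set 'rV[R]_n) (b : 'rV[R]_n * 'rV[R]_n).

(* A pair [b] of opposite corners encodes the closed box
   [b.1_0, b.2_0] x ... x [b.1_(n-1), b.2_(n-1)]; the box is empty and has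
   volume 0 when some side is reversed. *)
Definition box b : set 'rV[R]_n :=
  [set x | forall i, b.1 ord0 i <= x ord0 i <= b.2 ord0 i].

Definition box_volume b : R :=
  \prod_(i < n) Num.max 0 (b.2 ord0 i - b.1 ord0 i).

Definition box_cover A : set (set ('rV[R]_n * 'rV[R]_n)) :=
  [set C | countable C /\ A `<=` \bigcup_(b in C) box b].

Local Open Scope ereal_scope.

Definition lebesgue_outer A : \bar R :=
  ereal_inf [set \esum_(b in C) (box_volume b)%:E | C in box_cover A].

Lemma box_volume_ge0 b : 0 <= (box_volume b)%:E.
Proof. by rewrite lee_fin prodr_ge0// => i _; rewrite le_max lexx. Qed.

Lemma lebesgue_outer0 : lebesgue_outer set0 = 0.
Proof.
apply/eqP; rewrite eq_le; apply/andP; split.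
  apply: ereal_inf_lbound; exists set0; last exact: esum_set0.
  by split => //; exact: countable0.
apply: le_ereal_inf_tmp => _ [C _ <-].
by apply: esum_ge0 => b _; exact: box_volume_ge0.
Qed.

Lemma lebesgue_outer_ge0 A : 0 <= lebesgue_outer A.
Proof.
apply: le_ereal_inf_tmp => _ [C _ <-].
by apply: esum_ge0 => b _; exact: box_volume_ge0.
Qed.

Lemma le_lebesgue_outer :
  {homo lebesgue_outer : A B / A `<=` B >-> A <= B}.
Proof.
move=> A B AB; apply/ereal_inf_le_tmp => _ [C [Cc BC] <-].
by exists C => //; split=> //; exact: subset_trans BC.
Qed.

Lemma esum_bigcup_le (C : (set ('rV[R]_n * 'rV[R]_n))^nat) :
  \esum_(b in \bigcup_k C k) (box_volume b)%:E <=
  \sum_(k <oo) \esum_(b in C k) (box_volume b)%:E.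
Proof.
have v0 b : 0 <= (box_volume b)%:E := box_volume_ge0 b.
rewrite seqDU_bigcup_eq nneseries_sum_bigcup//.
apply: lee_nneseries => [k _ _|k _]; first by apply: esum_ge0 => b _.
rewrite esum_mkcond [leRHS]esum_mkcond; apply: le_esum => b _.
case: ifPn => [/set_mem Db|_]; last by case: ifPn.
by rewrite (mem_set (@subset_seqDU _ C k b Db)).
Qed.

Lemma lebesgue_outer_sigma_subadditive : sigma_subadditive lebesgue_outer.
Proof.
move=> A; have [[i ioo]|] := pselect (exists i, lebesgue_outer (A i) = +oo).
  rewrite (eseries_pinfty _ _ ioo) ?leey// => k _.
  by rewrite -ltNye (lt_le_trans _ (lebesgue_outer_ge0 _)).
rewrite -forallNE => Aoo.
apply/lee_addgt0Pr => e e0.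
rewrite (le_trans _ (epsilon_trick _ _ (ltW e0)))//; last first.
  by move=> k; exact: lebesgue_outer_ge0.
pose P k C := box_cover (A k) C /\ \esum_(b in C) (box_volume b)%:E <=
  lebesgue_outer (A k) + (e / (2 ^ k.+1)%:R)%:E.
have [C PC] : {C & forall k, P k (C k)}.
  apply: (@choice _ _ P) => k.
  have Ak : lebesgue_outer (A k) \is a fin_num.
    by rewrite ge0_fin_numE ?lebesgue_outer_ge0// ltey; exact/eqP/Aoo.
  have ek : (0 < e / (2 ^ k.+1)%:R)%R.
    by rewrite divr_gt0// ltr0n expn_gt0.
  have [_ [C AC <-] xlt] := lb_ereal_inf_adherent ek Ak.
  by exists C; split=> //; exact: ltW.
apply: (@le_trans _ _ (\esum_(b in \bigcup_k C k) (box_volume b)%:E)).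
  apply: ereal_inf_lbound; exists (\bigcup_k C k) => //; split.
    by apply: bigcup_countable => // k _; exact: (PC k).1.1.
  move=> x [k _ /(PC k).1.2[b Cb bx]].
  by exists b => //; exists k.
apply: (le_trans (esum_bigcup_le C)).
apply: lee_nneseries => [k _ _|k _]; last exact: (PC k).2.
by apply: esum_ge0 => b _; exact: box_volume_ge0.
Qed.

HB.instance Definition _ := isOuterMeasure.Build R 'rV[R]_n lebesgue_outer
  lebesgue_outer0 lebesgue_outer_ge0 le_lebesgue_outer
  lebesgue_outer_sigma_subadditive.

(* R^n with the complete sigma-algebra of Lebesgue (i.e., Caratheodory)
   measurable sets *)
Definition lebesgue_rV := caratheodory_type lebesgue_outer.

HB.instance Definition _ := Measurable.on lebesgue_rV.

Definition lebesgue_measure_rV : set lebesgue_rV -> \bar R := lebesgue_outer.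

HB.instance Definition _ := isMeasure.Build _ lebesgue_rV R lebesgue_measure_rV
  (@caratheodory_measure0 _ _ lebesgue_outer)
  (@caratheodory_measure_ge0 _ _ lebesgue_outer)
  (@caratheodory_measure_sigma_additive _ _ lebesgue_outer).

(* Extending [g] by +oo outside of [A] makes the values of [g] outside of [A]
   irrelevant (see [ess_inf_onE]). *)
Definition ess_inf_on A (g : 'rV[R]_n -> R) : \bar R :=
  ess_inf lebesgue_measure_rV (patch (fun=> +oo) A (EFin \o g)).

Lemma ess_inf_onE A g : ess_inf_on A g =
  ereal_sup [set c | {ae lebesgue_measure_rV, forall y, A y -> c <= (g y)%:E}].
Proof.
rewrite /ess_inf_on ess_infEae; congr ereal_sup; apply/seteqP.
have F := ae_filter_ringOfSetsType lebesgue_measure_rV.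
split=> c /=; apply: filterS => y.
  by move=> + Ay; rewrite /patch mem_set.
by rewrite /patch; case: ifPn => [/set_mem Ay /(_ Ay)//|_ _]; rewrite leey.
Qed.

End lebesgue_measure_rV.

Section convex_envelope.
Variables (R : realType) (E : lmodType R).
Implicit Types (g : E -> R) (h : E -> \bar R).
Local Open Scope ereal_scope.

Definition convex_minorant h : set (E -> R) :=
  [set g | convex_function setT g /\ forall z, (g z)%:E <= h z].

Definition convex_envelope h (z : E) : \bar R :=
  ereal_sup [set (g z)%:E | g in convex_minorant h].

Lemma convex_envelope_le h z : convex_envelope h z <= h z.
Proof. by apply: ge_ereal_sup => _ [g [_ gh] <-]. Qed.

Lemma convex_envelope_ge h g z : convex_minorant h g ->
  (g z)%:E <= convex_envelope h z.
Proof. by move=> hg; apply: ereal_sup_ubound; exists g. Qed.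

(* Whenever it is finite, [convex_envelope h] is the largest element of
   [convex_minorant h]. *)
Lemma convex_envelopeP h : (forall z, convex_envelope h z \is a fin_num) ->
  convex_minorant h (fine \o convex_envelope h) /\
  forall g, convex_minorant h g ->
    forall z, (g z <= fine (convex_envelope h z))%R.
Proof.
move=> hfin; split; last first.
  by move=> g hg z; rewrite -lee_fin fineK//; exact: convex_envelope_ge.
split; last by move=> z /=; rewrite fineK//; exact: convex_envelope_le.
move=> t x y _ _; rewrite -lee_fin /= fineK//.
apply: ge_ereal_sup => _ [g [cg gh] <-].
rewrite lee_fin (le_trans (cg t x y _ _)) ?inE//.
have le_g z : (g z <= fine (convex_envelope h z))%R.
  by rewrite -lee_fin fineK//; apply: convex_envelope_ge.
by apply: lerD; apply: ler_wpM2l; rewrite ?subr_ge0 ?le_g ?le1 ?ge0//.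
Qed.

End convex_envelope.

Definition ess_inf_ball (R : realType) (n N : nat)
    (f : 'rV[R]_n -> 'M[R]_(N, n) -> R) (x : 'rV[R]_n) (e : R)
    (z : 'M[R]_(N, n)) : \bar R :=
  ess_inf_on (eball x e) (f ^~ z).

(* Main.v *)
Require Import Defs.
From HB Require Import structures.
From mathcomp Require Import all_boot all_order all_algebra.
From mathcomp Require Import all_classical all_reals all_analysis.
From mathcomp Require Import lra.
Import Order.TTheory GRing.Theory Num.Theory.
Import numFieldNormedType.Exports.
Local Open Scope classical_set_scope.
Local Open Scope ring_scope.

(** Let [y'] be the point of the closed ball provided by (F4). The function
    [f y'] is convex and lies below [f y] for every [y] in the ball, hence
    below the essential infimum [f^-], so that it is a competitor in the
    definition of the convex envelope and [|z|^p <= f y' z <= (f^-)**(z)].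
    Comparing [x] with [y'] through (F2), and using [|x - y'| <= e], gives
    [f x z <= K1 (f^-)**(z) + K2 e^sigma |z|^q + K3].

    The assumption [|z|^p + (f^-)**(z) <= L e^-n] bounds [|z|^p] by [L e^-n],
    whence, with [s = (q - p) / p],
    [e^sigma |z|^q = e^sigma (|z|^p)^s |z|^p <= L^s e^(sigma - n s) |z|^p].
    The gap condition (F1) says exactly that [sigma - n s >= 0], and [e < 1],
    so the factor [e^(sigma - n s)] is at most [1] (lemma [powR_gap_le]). *)

Lemma enorm_ge0 (R : realType) (m n : nat) (A : 'M[R]_(m, n)) : 0 <= enorm A.
Proof. exact: sqrtr_ge0. Qed.

Lemma enormN (R : realType) (m n : nat) (A : 'M[R]_(m, n)) :
  enorm (- A) = enorm A.
Proof.
rewrite /enorm; congr Num.sqrt; apply: eq_bigr => i _; apply: eq_bigr => j _.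
by rewrite mxE sqrrN.
Qed.

Lemma continuous_enorm (R : realType) (m n : nat) :
  continuous (@enorm R m n).
Proof.
move=> A; rewrite /enorm.
apply: (@continuous_comp _ _ _
  (fun B : 'M[R]_(m, n) => \sum_i \sum_j B i j ^+ 2) Num.sqrt);
  last exact: sqrt_continuous.
move: A; apply: continuous_big => [|i _]; first exact: add_continuous.
apply: continuous_big => [|j _ A]; first exact: add_continuous.
apply: (@continuous_comp _ _ _ (fun B : 'M[R]_(m, n) => B i j)
  (fun r => r ^+ 2)); first exact: coord_continuous.
exact: exprn_continuous.
Qed.

(** The closure is taken for the topology of the sup norm, whereas the ball is
    Euclidean: continuity of the Euclidean norm relates the two. *)
Lemma closure_eball_le (R : realType) (n : nat) (x y : 'rV[R]_n) (e : R) :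
  closure (eball x e) y -> enorm (y - x) <= e.
Proof.
have cont : continuous (fun u : 'rV[R]_n => enorm (u - x)).
  have sub : continuous (fun u : 'rV[R]_n => u - x).
    by move=> u; exact: (cvgB (@cvg_id _ _) (cvg_cst x)).
  by move=> u; exact: (continuous_comp (sub u) (@continuous_enorm R 1 n _)).
have cl : closed ((fun u : 'rV[R]_n => enorm (u - x)) @^-1` [set r | r <= e]).
  by apply: preimage_closed; [move=> u _; exact: cont | exact: closed_le].
rewrite closureE => /(_ _ (conj cl _)); apply => u /=.
exact: ltW.
Qed.

Lemma ess_inf_on_ge (R : realType) (n : nat) (A : set 'rV[R]_n)
    (g : 'rV[R]_n -> R) (c : R) :
  (forall y, A y -> c <= g y) -> (c%:E <= ess_inf_on A g)%E.
Proof.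
move=> cg; rewrite ess_inf_onE; apply: ereal_sup_ubound => /=.
by apply: aeW => y /cg; rewrite lee_fin.
Qed.

(** A convex function [g] below all [f y], for [y] in the ball, is a convex
    minorant of the essential infimum. *)
Lemma convex_envelope_ess_inf_ball_ge (R : realType) (n N : nat)
    (f : 'rV[R]_n -> 'M[R]_(N, n) -> R) (g : 'M[R]_(N, n) -> R)
    (x : 'rV[R]_n) (e : R) (z : 'M[R]_(N, n)) :
  convex_function setT g -> (forall y w, eball x e y -> g w <= f y w) ->
  ((g z)%:E <= convex_envelope (ess_inf_ball f x e) z)%E.
Proof.
move=> cg gf; apply: convex_envelope_ge; split=> // w.
by apply: ess_inf_on_ge => y /gf.
Qed.

(** The only use of the gap condition: the power [t^(q - p)] in excess of
    [t^p] is paid by [e^sigma]. *)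
Lemma powR_gap_le (R : realType) (n : nat) (sigma p q L e t : R) :
  (0 < n)%N -> 0 < p -> p < q -> q <= p * (1 + sigma / n%:R) ->
  0 < L -> 0 < e -> e <= 1 -> 0 <= t -> t `^ p <= L * e ^- n ->
  e `^ sigma * t `^ q <= L `^ ((q - p) / p) * t `^ p.
Proof.
move=> n0 p0 pq gap L0 e0 e1 t0 tL.
set s := (q - p) / p.
have s0 : 0 <= s by apply: divr_ge0; [rewrite subr_ge0|]; exact: ltW.
have n0R : 0 < n%:R :> R by rewrite ltr0n.
have ns : n%:R * s <= sigma.
  rewrite mulrC -ler_pdivlMr// /s ler_pdivrMr//.
  by rewrite lerBlDl mulrC (le_trans gap)// mulrDr mulr1.
have [->|tn0] := eqVneq t 0.
  by rewrite !powR0 ?mulr0 ?gt_eqF// (lt_trans p0).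
have -> : t `^ q = (t `^ p) `^ s * t `^ p.
  rewrite -powRrM -powRD ?tn0 ?implybT//.
  by congr (_ `^ _); rewrite /s mulrC divfK ?gt_eqF// subrK.
rewrite mulrA ler_wpM2r ?powR_ge0//.
have tsL : (t `^ p) `^ s <= L `^ s * e `^ (- (n%:R * s)).
  rewrite -mulNr (powRrM e) powR_invn ?(ltW e0)//.
  rewrite -powRM ?(ltW L0) ?invr_ge0 ?exprn_ge0 ?(ltW e0)//.
  by rewrite ge0_ler_powR// nnegrE ?powR_ge0// (le_trans _ tL)// powR_ge0.
apply: (le_trans (ler_wpM2l (powR_ge0 _ _) tsL)).
rewrite mulrCA ger_pMr ?powR_gt0// -powRD ?(gt_eqF e0) ?implybT//.
rewrite -[leRHS](powRr0 e); apply: ger_powR; first by rewrite e0.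
by rewrite subr_ge0.
Qed.

Theorem theorem1p1 (R : realType) (n N : nat) (Omega : set 'rV[R]_n)
    (f : 'rV[R]_n -> 'M[R]_(N, n) -> R) (K1 K2 K3 sigma p q : R)
    (n_ge2 : (2 <= n)%N) (N_ge1 : (1 <= N)%N)
    (bounded_Omega : bounded_set Omega) (open_Omega : open Omega)
    (measurable_f : forall z,
      measurable_fun (Omega : set (lebesgue_rV R n)) (fun x => f x z))
    (K1_ge1 : 1 <= K1) (K2_ge0 : 0 <= K2) (K3_ge0 : 0 <= K3)
    (sigma_gt0 : 0 < sigma) (p_gt1 : 1 < p) (p_lt_q : p < q)
    (F1 : q <= p * (1 + sigma / n%:R))
    (F2 : forall (x x' : 'rV[R]_n) (z : 'M[R]_(N, n)), Omega x -> Omega x' ->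
      enorm z `^ p <= f x z /\
      f x z <= K1 * f x' z + K2 * enorm (x - x') `^ sigma * enorm z `^ q + K3)
    (F3 : forall x, Omega x -> convex_function setT (f x))
    (F4 : forall (x : 'rV[R]_n) (e : R), Omega x -> 0 < e -> closure (eball x e) `<=` Omega ->
      exists2 y', closure (eball x e) y' &
        forall y z, closure (eball x e) y -> f y' z <= f y z) :
  forall L e' : R, 0 < L -> 0 < e' < 1 ->
  forall (e : R) (x : 'rV[R]_n) (z : 'M[R]_(N, n)), 0 < e < e' -> Omega x -> closure (eball x e) `<=` Omega ->
    let fenv := convex_envelope (ess_inf_ball f x e) z in
    let A := K1 + K2 * L `^ ((q - p) / p) in
    ((enorm z `^ p)%:E + fenv <= (L * e ^- n)%:E)%E ->
    ((f x z)%:E <= A%:E * (fenv + K3%:E + (enorm z `^ p)%:E))%E.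
Proof.
move=> L e' L0 /andP[_ e'1] e x z /andP[e0 ee'] Ox ballO fenv A hL.
have [y' By' y'min] := F4 x e Ox e0 ballO.
have Oy' : Omega y' := ballO _ By'.
have fy'F : ((f y' z)%:E <= fenv)%E.
  apply: convex_envelope_ess_inf_ball_ge; first exact: F3.
  by move=> y w /subset_closure; exact: y'min.
(* The lower bound in (F2) holds at every pair of points, here [(y', y')]. *)
have tfy' : enorm z `^ p <= f y' z := (F2 y' y' z Oy' Oy').1.
(* [fenv] lies between the real numbers [f y' z] and, by [hL], [L * e ^- n]. *)
have fenv_fin : fenv \is a fin_num.
  rewrite fin_numE; apply/andP; split; apply/eqP => Fe.
    by move: fy'F; rewrite Fe.
  by move: hL; rewrite Fe.
move: fy'F hL; rewrite -(fineK fenv_fin); set F := fine fenv.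
rewrite -!EFinD -EFinM !lee_fin => fy'F hL.
have := (F2 x y' z Ox Oy').2.
set d := enorm (x - y'); set t := enorm z; set s := L `^ ((q - p) / p).
have tp0 : 0 <= t `^ p := powR_ge0 _ _.
have s0 : 0 <= s := powR_ge0 _ _.
have de : d <= e by rewrite /d -enormN opprB; exact: closure_eball_le.
have gap : d `^ sigma * t `^ q <= s * t `^ p.
  apply: (@le_trans _ _ (e `^ sigma * t `^ q)).
    rewrite ler_wpM2r ?powR_ge0//.
    by rewrite ge0_ler_powR ?nnegrE ?enorm_ge0 ?(ltW e0) ?(ltW sigma_gt0).
  apply: (powR_gap_le R n sigma p q L e t) => //; rewrite ?enorm_ge0//.
  - exact: ltn_trans n_ge2.
  - exact: lt_trans p_gt1.
  - exact/ltW/(lt_trans ee').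
  - by rewrite -/t in tfy' hL *; lra.
have K2gap : K2 * d `^ sigma * t `^ q <= K2 * s * t `^ p.
  by rewrite -!mulrA ler_wpM2l.
have K1F : K1 * f y' z <= K1 * F by rewrite ler_wpM2l// (le_trans _ K1_ge1).
have K2s0 : 0 <= K2 * s := mulr_ge0 K2_ge0 s0.
rewrite /A -/s; rewrite -/t in tfy' hL *.
move=> fxz; set c := K2 * s in K2gap K2s0 *.
have F0 : 0 <= F by lra.
(* In [A * (F + K3 + t `^ p)] the products [K1 * F], [c * t `^ p] and
   [K1 * K3 >= K3] dominate the bound on [f x z]; the others are
   nonnegative. *)
have cF0 : 0 <= c * F := mulr_ge0 K2s0 F0.
have cK3 : 0 <= c * K3 := mulr_ge0 K2s0 K3_ge0.
have K1K3 : K3 <= K1 * K3 by rewrite ler_peMl.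
have K1t : 0 <= K1 * t `^ p by rewrite mulr_ge0// (le_trans _ K1_ge1).
by rewrite mulrDl !mulrDr; lra.
Qed.
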